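(* Let $\mathbb K\in\{\mathbb R,\mathbb C\}$, $n,d\in\mathbb N$, and let $f\in\mathbb K\langle X_1,\dots,X_n\rangle$ be of degree at most $d$ and satisfy $$\operatorname{tr}(f(A_1,\dots,A_n))=0$$ for all self-adjoint contractions $A_1,\dots,A_n\in\mathbb K^{d\times d}$. In the case $\mathbb K=\mathbb R$, assume moreover that $f=f^*$. Then $f$ is cyclically equivalent to $0$, i.e., $f$ is a sum of commutators in $\mathbb K\langle X_1,\dots,X_n\rangle$.
   Context: $\mathbb N=\{1,2,3,\dots\}$. $\mathbb K\langle X_1,\dots,X_n\rangle$ is the free associative unital $\mathbb K$-algebra in noncommuting variables, with the involution $*$ that is complex conjugation on coefficients (the identity if $\mathbb K=\mathbb R$), satisfies $X_i^*=X_i$, and reverses words. Two polynomials $f,g$ are cyclically equivalent if $f-g$ is a sum of commutators $pq-qp$. A contraction is a matrix of operator norm at most $1$. *)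

(* Defs.v *)
From HB Require Import structures.
From mathcomp Require Import all_boot all_order all_algebra finmap.
From mathcomp Require Import monalg complex.
From mathcomp Require Import boolp classical_sets reals.

Set Implicit Arguments.
Unset Strict Implicit.
Unset Printing Implicit Defensive.

Import Order.TTheory GRing.Theory Num.Theory.

Local Open Scope ring_scope.
Local Open Scope classical_set_scope.

Variant base_field := RealField | ComplexField.

Definition scalars (R : realType) (k : base_field) : numFieldType :=
  match k with
  | RealField => R
  | ComplexField => R[i]
  end.

Definition conjK (R : realType) (k : base_field) : scalars R k -> scalars R k :=
  match k with
  | RealField => fun x => x
  | ComplexField => fun z => conjc z
  end.

(* The ring norm of R[i] takes its values in R[i]; absK is the R-valued
   modulus. *)
Definition absK (R : realType) (k : base_field) : scalars R k -> R :=
  match k with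
  | RealField => fun x => `|x|
  | ComplexField => fun z => complex.Re `|z|
  end.

(* The algebra of the free monoid of words in the letters 'I_n; its product
   concatenates words. *)
Notation freeAlg R k n := {malg (scalars R k)[{fmonom 'I_n}]}.

Section FreeAlgebra.
Context {R : realType} {k : base_field} {n : nat}.
Local Notation K := (scalars R k).
Local Notation A := (freeAlg R k n).

Definition star (f : A) : A :=
  \sum_(w <- msupp f) << conjK f@_w *g FMonom (rev w) >>.

(* mmeasure is one more than the largest length of a word in the support,
   and 0 for the zero polynomial. *)
Definition degree_at_most (d : nat) (f : A) : bool :=
  (mmeasure (@fdeg 'I_n) f <= d.+1)%N.

Definition cyclically_equivalent (f g : A) : Prop :=
  exists s : seq (A * A),
    f - g = \sum_(pq <- s) (pq.1 * pq.2 - pq.2 * pq.1).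

Definition evalmx (d : nat) (X : 'I_n -> 'M[K]_d) (f : A) : 'M[K]_d :=
  \sum_(w <- msupp f) f@_w *: \prod_(i <- (w : seq 'I_n)) X i.

End FreeAlgebra.

Section Matrices.
Context {R : realType} {k : base_field} {d : nat}.
Local Notation K := (scalars R k).

Definition adjmx (M : 'M[K]_d) : 'M[K]_d := (map_mx (@conjK R k) M)^T.

Definition selfadjoint (M : 'M[K]_d) : Prop := adjmx M = M.

Definition eucl_norm (v : 'cV[K]_d) : R :=
  Num.sqrt (\sum_(i < d) absK (v i ord0) ^+ 2).

Definition opnorm (M : 'M[K]_d) : R :=
  sup [set eucl_norm (M *m v) | v in [set v | eucl_norm v <= 1]].

Definition contraction (M : 'M[K]_d) : Prop := opnorm M <= 1.

End Matrices.

(* Main.v *)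
Require Import Defs.
From HB Require Import structures.
From mathcomp Require Import all_boot all_order all_algebra finmap.
From mathcomp Require Import monalg complex.
From mathcomp Require Import boolp classical_sets reals.
Import Order.TTheory GRing.Theory Num.Theory.
Local Open Scope ring_scope.
Set Implicit Arguments.
Unset Strict Implicit.
Unset Printing Implicit Defensive.

(** Fix a nonempty word v = x_0 ... x_m of length at most d. The heart of the
    matter is that the coefficients of f at the m+1 rotations of v sum to zero;
    since v - rot_s v is a commutator, f is then cyclically equivalent to its
    average over rotations, which vanishes.

    The coefficients at the rotations of v are read off from traces of products
    of elementary matrices. Let E_j be the matrix of the edge j -> j+1 of the
    oriented cycle on m+1 <= d vertices, and let e range over the bijections of
    the positions 0, ..., m. The trace of E_{e 0} ... E_{e m} is 1 if e runs
    once around the cycle, that is if e is a rotation, and 0 otherwise. Hence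
    the sum of coefficients is the value at B = E of
      P(B) = sum over e of f_{x_{e 0} ... x_{e m}} tr (B_{e 0} ... B_{e m}),
    which is the coefficient of t_0 ... t_m in the polynomial tr f(A), where A_i
    is the sum of the t_j B_j over the j with x_j = i ([polarization]).

    If every B_j is self-adjoint then P(B) = 0. Indeed, dividing self-adjoint
    matrices by a large integer makes them contractions, so tr f(A / M) = 0 for
    all large M; this is a polynomial in 1 / M, whence every homogeneous
    component of f has trace zero on self-adjoint tuples
    ([homogeneous_trace_eq0]). Averaging over signs t_j then isolates P(B)
    ([polarization_eq0]).

    It remains to pass from self-adjoint B to the matrices E_j, and here the two
    fields differ. Over the complex numbers E_j is a complex combination of
    self-adjoint matrices and P is multilinear
    ([polarization_edges_hermitian]). Over the reals, expand P at the symmetric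
    matrices E_j + E_j^T. A closed walk that uses every edge of the cycle
    exactly once never turns back, so only P(E) and P(E^T) survive; they agree
    because f = f^*, so that 2 P(E) = 0 ([polarization_edges_symmetric]). *)

(** * Traces of products of elementary matrices, and sign averages *)

Lemma prod_delta_mx (R : comNzRingType) (d : nat) (I : Type) (a b : I -> 'I_d)
    (x : I) (s : seq I) :
  \prod_(j <- x :: s) delta_mx (a j) (b j) =
  (path (fun y z => b y == a z) x s)%:R *: delta_mx (a x) (b (last x s))
    :> 'M[R]_d.
Proof.
elim: s x => [|y s IHs] x; first by rewrite big_seq1 scale1r.
rewrite big_cons IHs -mulmxE -scalemxAr mul_delta_mx_cond /=.
by case: eqP => _; rewrite ?mulr1n //= mulr0n scaler0 scale0r.
Qed.

Lemma mxtrace_prod_delta_mx (R : comNzRingType) (d : nat) (I : Type)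
    (a b : I -> 'I_d) (s : seq I) : (0 < size s)%N ->
  \tr (\prod_(j <- s) delta_mx (a j) (b j)) =
  (cycle (fun y z => b y == a z) s)%:R :> R.
Proof.
case: s => // x s _; rewrite prod_delta_mx mxtraceZ /= rcons_path.
have -> : \tr (delta_mx (a x) (b (last x s))) = (b (last x s) == a x)%:R :> R.
  rewrite /mxtrace (bigD1 (a x)) //= big1 ?addr0 => [|i ne].
    by rewrite mxE eqxx eq_sym.
  by rewrite mxE (negPf ne).
by rewrite -natrM mulnb.
Qed.

(** The successor [ordS] is cyclic, so the condition at the last index is the
    one that closes the cycle. *)
Lemma cycle_codom (T : eqType) (r : rel T) (m : nat) (e : {ffun 'I_m.+1 -> T}) :
  cycle r (codom e) = [forall l, r (e l) (e (ordS l))].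
Proof.
rewrite codomE cycle_map.
have Uq := enum_uniq 'I_m.+1.
have nextE l : next (enum 'I_m.+1) l = ordS l.
  rewrite next_nth mem_enum inE; case def_p: (enum 'I_m.+1) => [|y p].
    by have := size_enum_ord m.+1; rewrite def_p.
  rewrite -def_p index_enum_ord; apply: val_inj => /=.
  have sz_p: size p = m.
    by have := size_enum_ord m.+1; rewrite def_p => -[].
  have y0 : val y = 0%N.
    by have := nth_enum_ord y (ltn0Sn m); rewrite def_p.
  have lt_l : (l <= m)%N by exact: (ltn_ord (l : 'I_m.+1)).

  have [lt_lm|ge_lm] := ltnP l m; last first.
    have lm : l = m :> nat by apply/eqP; rewrite eqn_leq lt_l.
    by rewrite nth_default ?sz_p // lm modnn.
  have := @nth_enum_ord m.+1 y l.+1 lt_lm; rewrite def_p /= => ->.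
  by rewrite modn_small.
apply/idP/forallP => [cyc l | H].
  by have := next_cycle cyc (mem_enum 'I_m.+1 l); rewrite nextE.
apply: cycle_from_next => [|l _]; first exact: Uq.
by rewrite nextE; exact: H.
Qed.

(** Averaging against the product of all signs keeps the monomials in which each
    sign occurs to an odd power; a monomial of degree [m] in [m] signs with that
    property contains each sign once, hence is indexed by a bijection. *)
Lemma sum_sign_monomials (R : comNzRingType) (m : nat) (e : {ffun 'I_m -> 'I_m}) :
  \sum_(t : {ffun 'I_m -> bool})
     (\prod_j (-1) ^+ t j) * (\prod_l (-1) ^+ t (e l)) =
  (if injectiveb e then 2 ^+ m else 0) :> R.
Proof.
pose c j := #|[pred l | e l == j]|.
have -> : \sum_(t : {ffun 'I_m -> bool})
     (\prod_j (-1) ^+ t j) * (\prod_l (-1) ^+ t (e l)) =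
   \prod_(j : 'I_m) \sum_(b : bool) ((-1) ^+ b) ^+ (c j).+1 :> R.
  rewrite bigA_distr_bigA; apply: eq_bigr => t _ /=.
  rewrite [X in _ * X](partition_big e predT) //= -big_split /=.
  apply: eq_bigr => j _; rewrite exprS; congr (_ * _).
  rewrite (eq_bigr (fun=> (-1) ^+ t j)) => [|l /eqP-> //].
  by rewrite prodr_const.
have [/injectiveP inj|ninj] := ifP.
  rewrite -[m in RHS]card_ord -prodr_const; apply: eq_bigr => j _.
  have -> : c j = 1%N.
    have /codomP [l def_j] : j \in codom e by apply: inj_card_onto.
    rewrite -(card1 l); apply: eq_card => l'.
    by rewrite !inE def_j (inj_eq inj).
  by rewrite big_bool /= sqrrN !expr1n.
(* By finiteness a map that is not injective misses some index [j]; the factor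
   of [j] in the product is then 1 - 1. *)
have /existsP [j /eqP c0] : [exists j, c j == 0%N].
  apply: contraFT ninj => /existsPn nc0.
  apply/injectiveP => l l'; apply: (image_injP (A := predT) _) => //.
  apply/eqP/eq_card => j; rewrite inE.
  have [i /eqP <-|none] := pickP [pred l | e l == j]; first exact: codom_f.
  by have := nc0 j; rewrite /c (eq_card0 none).
rewrite (bigD1 j) //= c0 big_bool /= !expr1 expr0 addrC.
by rewrite subrr mul0r.
Qed.

(** * Polarization of the trace *)

Lemma sum_msupp_pred1 (T : choiceType) (G V : zmodType) (f : {malg G[T]}) (x : T)
    (F : T -> V) :
  (x \notin msupp f -> F x = 0) -> \sum_(v <- msupp f | v == x) F v = F x.
Proof.
move=> F0; have [xf|xf] := boolP (x \in msupp f).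
  rewrite big_mkcond (big_fsetD1 x) //= eqxx big1_seq ?addr0 // => v.
  by rewrite in_fsetD1 => /andP[_ /andP[/negPf-> _]].
rewrite F0 // big1_seq // => v /andP[/eqP-> xf'].
by rewrite xf' in xf.
Qed.

Section Polarization.
Context {K : numFieldType} {n d m : nat}.
Implicit Types (f : {malg K[{fmonom 'I_n}]}) (w : 'I_m -> 'I_n).
Implicit Types (B : 'I_m -> 'M[K]_d) (e : {ffun 'I_m -> 'I_m}).

(** The coefficient of the product of all [t j] in the trace of [f] evaluated at
    the matrices that send the letter [i] to the sum of the [t j *: B j] over the
    positions [j] of the word [w] with [w j = i]. *)
Definition polarization f w B : K :=
  \sum_(e : {ffun 'I_m -> 'I_m} | injectiveb e)
    f@_(FMonom (map w (codom e))) * \tr (\prod_(j <- codom e) B j).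

Lemma prod_scale_mx (I : Type) (s : seq I) (c : I -> K) (B : I -> 'M[K]_d) :
  \prod_(j <- s) (c j *: B j) = (\prod_(j <- s) c j) *: \prod_(j <- s) B j.
Proof.
elim: s => [|j s IHs]; first by rewrite !big_nil scale1r.
by rewrite !big_cons IHs -!mulmxE -scalemxAl -scalemxAr scalerA.
Qed.

Lemma prod_codom (R : pzSemiRingType) (I : finType) (T : Type) (e : {ffun I -> T})
  (F : T -> R) : \prod_(j <- codom e) F j = \prod_(l : I) F (e l).
Proof. by rewrite codomE big_map enumT. Qed.

Lemma tr_prod_letter_sums w B (c : 'I_m -> K) (v : seq 'I_n) :
  size v = m ->
  \tr (\prod_(i <- v) \sum_(j | w j == i) c j *: B j) =
  \sum_(e : {ffun 'I_m -> 'I_m} | map w (codom e) == v)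
    (\prod_l c (e l)) * \tr (\prod_(j <- codom e) B j).
Proof.
move=> sz_v; have sz_v' : size v == m by apply/eqP.
rewrite -[v]/(tval (Tuple sz_v')); move: (Tuple sz_v') => {sz_v sz_v'}{}v.
rewrite big_tuple bigA_distr_big_dep raddf_sum /=.
apply: eq_big => [e|e _].
  apply/familyP/eqP => [fam|eq_v l].
    rewrite -[RHS]map_tnth_enum codomE -map_comp.
    by apply: eq_map => l; apply/eqP; exact: fam.
  move: eq_v; rewrite -[RHS]map_tnth_enum codomE -map_comp => /eq_in_map eq_v.
  by apply/eqP; apply: eq_v; rewrite mem_enum.
by rewrite -(prod_codom e (fun j => c j *: B j)) prod_scale_mx mxtraceZ prod_codom.
Qed.

(** With signs as the values of the variables, the substituted matrices are
    signed sums of the [B j] and so stay in the additive group [S];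
    [sum_sign_monomials] extracts the multilinear part. *)
Lemma polarization_eq0 f w B (S : 'M[K]_d -> Prop) :
  S 0 -> (forall X Y, S X -> S Y -> S (X - Y)) ->
  (forall A : 'I_n -> 'M[K]_d, (forall i, S (A i)) ->
    \sum_(v <- msupp f | size v == m) f@_v * \tr (\prod_(i <- (v : seq _)) A i) = 0) ->
  (forall j, S (B j)) -> polarization f w B = 0.
Proof.
move=> S0 SB trf0 BS.
have SN X : S X -> S (- X) by move=> SX; rewrite -sub0r; apply: SB.
have SD X Y : S X -> S Y -> S (X + Y).
  by move=> SX SY; rewrite -[Y]opprK; apply: SB => //; apply: SN.
pose A (t : {ffun 'I_m -> bool}) i := \sum_(j | w j == i) (-1) ^+ t j *: B j.
have AS t i : S (A t i).
  rewrite /A; elim/big_ind: _ => // j _; case: (t j).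
    by rewrite expr1 scaleN1r; apply: SN.
  by rewrite expr0 scale1r.
have trA t : \sum_(v <- msupp f | size v == m)
      f@_v * \tr (\prod_(i <- (v : seq _)) A t i) =
    \sum_(e : {ffun 'I_m -> 'I_m}) (\prod_l (-1) ^+ t (e l)) *
      (f@_(FMonom (map w (codom e))) * \tr (\prod_(j <- codom e) B j)).
  under eq_bigr => v /eqP sz_v do rewrite /A tr_prod_letter_sums // big_distrr /=.
  rewrite (exchange_big_dep predT) //=; apply: eq_bigr => e _.
  pose u := FMonom (map w (codom e)).
  have sz_u : size u = m by rewrite size_map size_codom card_ord.
  rewrite (eq_bigl (pred1 u)) => [|v]; last first.
    rewrite /= -[in RHS]val_eqE /= [RHS]eq_sym; apply: andb_idl => /eqP <-.
    exact/eqP.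
  rewrite sum_msupp_pred1 => [|us]; first by rewrite mulrCA.
  by rewrite mcoeff_outdom ?mul0r.
have : \sum_(t : {ffun 'I_m -> bool}) (\prod_j (-1) ^+ t j) *
    \sum_(v <- msupp f | size v == m)
      f@_v * \tr (\prod_(i <- (v : seq _)) A t i) = 0.
  by apply: big1 => t _; rewrite trf0 ?mulr0.
under eq_bigr => t _ do rewrite trA big_distrr /=.
rewrite exchange_big /=.
under eq_bigr => e _.
  under eq_bigr => t _ do rewrite mulrA.
  rewrite -mulr_suml sum_sign_monomials; over.
rewrite (bigID (fun e : {ffun 'I_m -> 'I_m} => injectiveb e)) /= [X in _ + X]big1.
  rewrite addr0 => sum0; apply: (@mulfI _ (2 ^+ m)).
    by rewrite expf_neq0 // pnatr_eq0.
  rewrite mulr0 -[RHS]sum0 big_distrr /=.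
  by apply: eq_bigr => e ->.
by move=> e /negPf->; rewrite mul0r.
Qed.

Lemma polarization_multilinear f w (c : bool -> K) (C : bool -> 'I_m -> 'M[K]_d) :
  polarization f w (fun j => \sum_(b : bool) c b *: C b j) =
  \sum_(t : {ffun 'I_m -> bool})
    (\prod_j c (t j)) * polarization f w (fun j => C (t j) j).
Proof.
rewrite /polarization.
under [RHS]eq_bigr => t _ do rewrite big_distrr /=.
rewrite exchange_big /=; apply: eq_bigr => e /injectiveP inj.
rewrite prod_codom bigA_distr_bigA raddf_sum big_distrr /=.
pose h (t : {ffun 'I_m -> bool}) : {ffun 'I_m -> bool} := [ffun l => t (e l)].
have h_bij : bijective h.
  exists (fun t : {ffun 'I_m -> bool} =>
    [ffun l => t (invF inj l)] : {ffun 'I_m -> bool}) => t; apply/ffunP => l.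
    by rewrite !ffunE f_invF.
  by rewrite !ffunE invF_f.
rewrite (reindex h) /=; last exact: onW_bij.
apply: eq_bigr => t _.
rewrite mulrCA; congr (_ * _).
rewrite prod_scale_mx mxtraceZ prod_codom; congr (_ * _).
  rewrite [RHS](reindex_inj inj) /=; apply: eq_bigr => l _.
  by rewrite ffunE.
by congr (\tr _); apply: eq_bigr => l _; rewrite ffunE.
Qed.

Lemma prod_trmx (I : Type) (s : seq I) (B : I -> 'M[K]_d) :
  (\prod_(j <- s) B j)^T = \prod_(j <- rev s) (B j)^T.
Proof.
elim: s => [|j s IHs]; first by rewrite !big_nil trmx1.
by rewrite big_cons rev_cons -cats1 big_cat big_seq1 -IHs -!mulmxE trmx_mul.
Qed.

(** Transposing a product reverses its factors, which amounts to reversing the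
    positions, hence the words of [f]. *)
Lemma polarization_trmx f w B :
  (forall v, f@_(FMonom (rev v)) = f@_(FMonom v)) ->
  polarization f w (fun j => (B j)^T) = polarization f w B.
Proof.
move=> f_rev.
pose h (e : {ffun 'I_m -> 'I_m}) : {ffun 'I_m -> 'I_m} := [ffun l => e (rev_ord l)].
have hK : involutive h by move=> e; apply/ffunP => l; rewrite !ffunE rev_ordK.
have codom_h e : codom (h e) = rev (codom e).
  rewrite !codomE -map_rev -[enum 'I_m in RHS]/(enum 'I_m).
  have -> : rev (enum 'I_m) = map (@rev_ord m) (enum 'I_m).
    apply: (inj_map val_inj); apply: (@eq_from_nth _ 0%N) => [|l].
      by rewrite map_rev size_rev !size_map.
    rewrite map_rev val_enum_ord size_rev size_iota => lt_lm.
    rewrite nth_rev ?size_iota // nth_iota ?add0n; last first.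
      by rewrite ltn_subrL (leq_ltn_trans _ lt_lm).
    rewrite -map_comp (nth_map (Ordinal lt_lm)) ?size_enum_ord //=.
    by rewrite nth_enum_ord.
  rewrite -[RHS](map_comp e (@rev_ord m)); apply/eq_in_map => l _.
  by rewrite ffunE.
rewrite /polarization (reindex_inj (can_inj hK)) /=.
apply: eq_big => [e|e _].
  by rewrite -[LHS]/(uniq (codom (h e))) codom_h rev_uniq.
rewrite codom_h map_rev f_rev; congr (_ * _).
rewrite -[LHS]mxtrace_tr prod_trmx revK; congr (\tr _).
by apply: eq_bigr => j _; rewrite trmxK.
Qed.

End Polarization.

(** * The oriented cycle *)

Section CyclicGraph.
Context {K : numFieldType} {n d m : nat} (le_md : (m.+1 <= d)%N).
Implicit Types (f : {malg K[{fmonom 'I_n}]}) (w : 'I_m.+1 -> 'I_n).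
Implicit Types (e : {ffun 'I_m.+1 -> 'I_m.+1}) (s : 'I_m.+1).

Local Notation vertex := (widen_ord le_md).

Definition edge_mx (j : 'I_m.+1) : 'M[K]_d :=
  delta_mx (vertex j) (vertex (ordS j)).

Definition rotation s : {ffun 'I_m.+1 -> 'I_m.+1} := [ffun l => s + l].

Lemma vertex_inj : injective vertex.
Proof. by move=> i j /(congr1 val) /= /val_inj. Qed.

Lemma addr_ordS (i j : 'I_m.+1) : i + ordS j = ordS (i + j).
Proof.
by apply: val_inj; rewrite /= modnDmr addnS -[in RHS]addn1 modnDml addn1.
Qed.

Lemma ordS_ind (P : 'I_m.+1 -> Prop) :
  P 0 -> (forall l, P l -> P (ordS l)) -> forall l, P l.
Proof.
move=> P0 PS [l lt_l]; elim: l lt_l => [|l IHl] lt_l.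
  by rewrite (_ : Ordinal lt_l = 0) //; apply: val_inj.
rewrite (_ : Ordinal lt_l = ordS (Ordinal (ltnW lt_l))); first exact: PS.
by apply: val_inj; rewrite /= modn_small.
Qed.

Lemma rotationP e :
  reflect (e = rotation (e 0)) [forall l, ordS (e l) == e (ordS l)].
Proof.
apply: (iffP forallP) => [eS|-> l]; last by rewrite !ffunE addr_ordS.
apply/ffunP; apply: ordS_ind => [|l eq_l]; rewrite ffunE ?addr0 //.
by rewrite -(eqP (eS l)) eq_l addr_ordS ffunE.
Qed.

Lemma rotation_inj s : injective (rotation s).
Proof. by move=> i j; rewrite !ffunE => /addrI. Qed.

(** A product of edges has nonzero trace only when each edge starts where the
    previous one ends, cyclically. *)
Lemma polarization_edges f w :
  polarization f w edge_mx =
  \sum_s f@_(FMonom (map w (codom (rotation s)))).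
Proof.
rewrite [RHS](reindex_onto (fun e : {ffun 'I_m.+1 -> 'I_m.+1} => e 0) rotation);
  last by move=> s _; rewrite ffunE addr0.
rewrite /polarization (bigID (fun e => e == rotation (e 0))) /=.
rewrite [X in _ + X]big1 ?addr0 => [|e /andP[_ ne]].
  apply: eq_big => [e|e /andP[inj /eqP eq_e]].
    rewrite [RHS]eq_sym; apply: andb_idl => /eqP ->; apply/injectiveP.
    exact: rotation_inj.
  rewrite -eq_e mxtrace_prod_delta_mx ?size_codom ?card_ord // cycle_codom.
  rewrite (_ : [forall l, _] = true) ?mulr1 //; apply/forallP => l.
  rewrite (inj_eq vertex_inj); move: l.
  exact/forallP/rotationP.
rewrite mxtrace_prod_delta_mx ?size_codom ?card_ord // cycle_codom.
rewrite (_ : [forall l, _] = false) ?mulr0 //; apply: contraNF ne => /forallP cyc.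
apply/eqP/rotationP/forallP => l; have := cyc l.
by rewrite (inj_eq vertex_inj).
Qed.

(** Some edges are traversed forwards and others backwards. In a closed walk
    two consecutive edges of opposite orientation would have to be equal, but
    each edge is used exactly once. *)
Lemma polarization_mixed_edges f w (t : {ffun 'I_m.+1 -> bool}) :
  (forall b, t != [ffun=> b]) ->
  polarization f w (fun j => if t j then edge_mx j else (edge_mx j)^T) = 0.
Proof.
move=> nconst; apply: big1 => e /injectiveP inj.
pose tail j := if t j then vertex j else vertex (ordS j).
pose head j := if t j then vertex (ordS j) else vertex j.
rewrite (eq_bigr (fun j => delta_mx (tail j) (head j))) => [|j _]; last first.
  by rewrite /tail /head; case: (t j); rewrite // trmx_delta.
rewrite mxtrace_prod_delta_mx ?size_codom ?card_ord // cycle_codom.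
rewrite (_ : [forall l, _] = false) ?mulr0 //.
apply: contraNF (nconst (t (e 0))) => /forallP cyc.
have t_const l : t (e l) = t (e 0).
  elim/ordS_ind: l => // l <-; have := cyc l; rewrite /head /tail.
  case tl: (t (e l)); case tSl: (t (e (ordS l))); rewrite ?(inj_eq vertex_inj) //.
    by move=> /eqP/ordS_inj/inj eq_l; rewrite -eq_l tl in tSl.
  by move=> /eqP/inj eq_l; rewrite -eq_l tl in tSl.
by apply/eqP/ffunP => j; rewrite ffunE -(f_invF inj j) t_const.
Qed.

(** Among the orientations in the expansion at [edge_mx j + (edge_mx j)^T], the
    two constant ones contribute equally and all the others vanish. *)
Lemma polarization_edges_symmetric f w :
  (forall v, f@_(FMonom (rev v)) = f@_(FMonom v)) ->
  (forall B : 'I_m.+1 -> 'M[K]_d, (forall j, (B j)^T = B j) ->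
    polarization f w B = 0) ->
  polarization f w edge_mx = 0.
Proof.
move=> f_rev sym0; pose C (b : bool) j := if b then edge_mx j else (edge_mx j)^T.
have := polarization_multilinear f w (fun=> 1) C.
rewrite sym0 => [|j]; last first.
  by rewrite big_bool /= !scale1r [LHS]raddfD /= trmxK addrC.
rewrite (bigD1 [ffun=> true]) // (bigD1 [ffun=> false]) /=; last first.
  by apply/eqP => /ffunP/(_ 0); rewrite !ffunE.
rewrite [X in _ + (_ + X)]big1 => [|t /andP[t1 t0]]; last first.
  by rewrite polarization_mixed_edges ?mulr0 //; case.
rewrite !big1 // !mul1r addr0.
have -> : polarization f w (fun j => C ([ffun=> true] j) j) = polarization f w edge_mx.
  by congr polarization; apply/funext => j; rewrite ffunE.
have -> : polarization f w (fun j => C ([ffun=> false] j) j) = polarization f w edge_mx.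
  rewrite -[RHS]polarization_trmx //.
  by congr polarization; apply/funext => j; rewrite ffunE.
by move=> /esym/eqP; rewrite -mulr2n mulrn_eq0 => /eqP.
Qed.

(** When [i] is the imaginary unit, the two alternatives are the self-adjoint
    matrices H and K with [edge_mx j] = (H + i K) / 2. *)
Lemma polarization_edges_hermitian f w (i : K) : i * i = -1 ->
  (forall B : 'I_m.+1 -> 'M[K]_d,
    (forall j, B j = edge_mx j + (edge_mx j)^T \/
               B j = - i *: (edge_mx j - (edge_mx j)^T)) ->
    polarization f w B = 0) ->
  polarization f w edge_mx = 0.
Proof.
move=> i2 herm0.
pose C (b : bool) j := if b then edge_mx j + (edge_mx j)^T
                       else - i *: (edge_mx j - (edge_mx j)^T).
pose c (b : bool) : K := if b then 2^-1 else i / 2.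
have -> : edge_mx = (fun j => \sum_(b : bool) c b *: C b j).
  apply/funext => j; rewrite big_bool /= scalerA mulrAC mulrN.
  rewrite i2 opprK mul1r -scalerDr addrACA subrr addr0.
  by rewrite -mulr2n -scaler_nat scalerA mulVf ?scale1r ?pnatr_eq0.
rewrite polarization_multilinear big1 // => t _.
rewrite herm0 ?mulr0 // => j; rewrite /C.
by case: (t j); [left | right].
Qed.

End CyclicGraph.

(** * Self-adjoint matrices and homogeneous components *)

Section Scalars.
Context {R : realType} {k : base_field}.
Local Notation K := (scalars R k).
Implicit Types x y : K.

Lemma conjKD x y : conjK (x + y) = conjK x + conjK y.
Proof. by case: k x y => //= x y; rewrite rmorphD. Qed.

Lemma conjKM x y : conjK (x * y) = conjK x * conjK y.
Proof. by case: k x y => //= x y; rewrite rmorphM. Qed.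

Lemma conjKK x : conjK (conjK x) = x.
Proof. by case: k x => //= x; rewrite conjcK. Qed.

Lemma conjK0 : conjK (0 : K) = 0.
Proof. by case: k => //; exact: conjc0. Qed.

Lemma conjKN x : conjK (- x) = - conjK x.
Proof. by case: k x => //= x; rewrite rmorphN. Qed.

Lemma conjK_natV (M : nat) : conjK (M%:R^-1 : K) = M%:R^-1.
Proof. by case: k => //=; rewrite fmorphV rmorph_nat. Qed.

Lemma conjK_nat (b : nat) : conjK (b%:R : K) = b%:R.
Proof. by case: k => //=; rewrite rmorph_nat. Qed.

Lemma absK_ge0 x : 0 <= absK x.
Proof.
case: k x => /= x; first exact: normr_ge0.
by case: x => a b /=; exact: sqrtr_ge0.
Qed.

Lemma absK0 : absK (0 : K) = 0.
Proof. by case: k; [exact: normr0 | exact: Normc.normc0]. Qed.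

Lemma absKM x y : absK (x * y) = absK x * absK y.
Proof.
case: k x y => /= x y; first exact: normrM.
exact: Normc.normcM.
Qed.

Lemma absKD x y : absK (x + y) <= absK x + absK y.
Proof.
case: k x y => /= x y; first exact: ler_normD.
exact: le_normcD.
Qed.

Lemma absK_natV (M : nat) : absK (M%:R^-1 : K) = M%:R^-1.
Proof.
case: k => /=; first by rewrite ger0_norm // invr_ge0 ler0n.
by rewrite Normc.normcV normcMn Normc.normc1.
Qed.

Lemma absK_sum (I : Type) (s : seq I) (F : I -> K) :
  absK (\sum_(i <- s) F i) <= \sum_(i <- s) absK (F i).
Proof.
elim: s => [|i s IHs].
  by rewrite !big_nil absK0.
by rewrite !big_cons (le_trans (absKD _ _)) // lerD2l.
Qed.

End Scalars.

Section SmallMatrices.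
Context {R : realType} {k : base_field} {d : nat}.
Local Notation K := (scalars R k).
Implicit Types A B : 'M[K]_d.

Lemma adjmxB A B : adjmx (A - B) = adjmx A - adjmx B.
Proof. by apply/matrixP => i j; rewrite !mxE conjKD conjKN. Qed.

Lemma adjmxD A B : adjmx (A + B) = adjmx A + adjmx B.
Proof. by apply/matrixP => i j; rewrite !mxE conjKD. Qed.

Lemma adjmxZ (a : K) A : adjmx (a *: A) = conjK a *: adjmx A.
Proof. by apply/matrixP => i j; rewrite !mxE conjKM. Qed.

Lemma adjmxK A : adjmx (adjmx A) = A.
Proof. by apply/matrixP => i j; rewrite !mxE conjKK. Qed.

Lemma adjmx_delta (i j : 'I_d) : adjmx (delta_mx i j : 'M[K]_d) = delta_mx j i.
Proof. by apply/matrixP => x y; rewrite !mxE andbC conjK_nat. Qed.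

Lemma adjmx0 : adjmx (0 : 'M[K]_d) = 0.
Proof. by apply/matrixP => i j; rewrite !mxE conjK0. Qed.

Lemma selfadjoint_natV (M : nat) A :
  selfadjoint A -> selfadjoint (M%:R^-1 *: A).
Proof.
move=> Asa; apply/matrixP => i j; rewrite !mxE conjKM conjK_natV.
by rewrite -[in RHS]Asa !mxE.
Qed.

(** On the unit ball each entry of [A *m v] is at most d / d^2 = 1 / d, so the
    norm of [A *m v] is at most sqrt (d / d^2). *)
Lemma contraction_small_entries A :
  (0 < d)%N -> (forall i j, absK (A i j) <= (d%:R ^+ 2)^-1) -> contraction A.
Proof.
move=> d_gt0 Aij; have dR : 0 < d%:R :> R by rewrite ltr0n.
apply: ge_sup.
  exists (eucl_norm (A *m 0)), 0 => //=.
  rewrite /eucl_norm big1 ?sqrtr0 ?ler01 // => i _.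
  by rewrite mxE absK0 expr0n.
move=> _ [v /= v1 <-].
have vj j : absK (v j ord0) <= 1.
  apply: le_trans v1; rewrite -[leLHS]ger0_norm ?absK_ge0 // -sqrtr_sqr.
  rewrite ler_wsqrtr // (bigD1 j) //= lerDl sumr_ge0 // => i _; exact: sqr_ge0.
rewrite /eucl_norm -[leRHS]sqrtr1 ler_wsqrtr //.
have Avi i : absK ((A *m v) i ord0) ^+ 2 <= d%:R^-1 ^+ 2.
  rewrite ler_pXn2r ?nnegrE ?absK_ge0 ?invr_ge0 ?ler0n // mxE.
  apply: le_trans (absK_sum _ _) _.
  apply: (@le_trans _ _ (\sum_(j < d) (d%:R ^+ 2)^-1)).
    apply: ler_sum => j _; rewrite absKM -[leRHS]mulr1.
    by apply: ler_pM; rewrite ?absK_ge0.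
  rewrite sumr_const card_ord -[leLHS]mulr_natr expr2 invfM divfK //.
  by rewrite gt_eqF.
apply: le_trans (ler_sum _ (fun i _ => Avi i)) _.
rewrite sumr_const card_ord -[leLHS]mulr_natr expr2 divfK ?gt_eqF //.
by rewrite invf_le1 // ler1n.
Qed.

(** Scaling by inverses of integers suffices below and keeps the scaling factor
    inside both scalar fields, without an embedding of [R]. *)
Lemma contraction_natV A :
  (0 < d)%N -> exists N : nat, forall M : nat, (N <= M)%N ->
    contraction (M%:R^-1 *: A).
Proof.
move=> d_gt0; pose C := \sum_i \sum_j absK (A i j).
have C_ge0 : 0 <= C by do 2![apply: sumr_ge0 => ? _]; exact: absK_ge0.
have dR : 0 < d%:R :> R by rewrite ltr0n.
exists (Num.Def.archi_bound (d%:R ^+ 2 * C)) => M le_M.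
have Mbig : d%:R ^+ 2 * C < M%:R.
  apply: lt_le_trans (archi_boundP _) _; last by rewrite ler_nat.
  by rewrite mulr_ge0 // exprn_ge0 // ltW.
have M_gt0 : 0 < M%:R :> R.
  by apply: le_lt_trans Mbig; rewrite mulr_ge0 // exprn_ge0 // ltW.
apply: contraction_small_entries => // i j.
rewrite mxE absKM absK_natV mulrC ler_pdivrMr // mulrC ler_pdivlMr ?exprn_gt0 //.
rewrite mulrC; apply: le_trans (ltW Mbig); rewrite ler_pM2l ?exprn_gt0 //.
rewrite /C (bigD1 i) //= (bigD1 j) //= -addrA lerDl addr_ge0 //.
  by apply: sumr_ge0 => ? _; exact: absK_ge0.
by do 2![apply: sumr_ge0 => ? _]; exact: absK_ge0.
Qed.

End SmallMatrices.

Lemma poly_natV_roots_eq0 (K : numFieldType) (p : {poly K}) (N : nat) :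
  (forall M : nat, (N <= M)%N -> p.[M%:R^-1] = 0) -> p = 0.
Proof.
move=> p0; apply/eqP; apply: contraTT isT => p_neq0.
pose rs : seq K := [seq (M%:R)^-1 | M <- iota N (size p)].
have rs_roots : all (root p) rs.
  apply/allP => _ /mapP[M + ->]; rewrite mem_iota => /andP[leNM _].
  exact/eqP/p0.
have rs_uniq : uniq rs.
  rewrite map_inj_uniq ?iota_uniq // => M M' /invr_inj/eqP.
  by rewrite eqr_nat => /eqP.
have := max_poly_roots p_neq0 rs_roots rs_uniq.
by rewrite size_map size_iota ltnn.
Qed.

Section Homogeneity.
Context {R : realType} {k : base_field} {n d : nat}.
Local Notation K := (scalars R k).
Implicit Types f : freeAlg R k n.

(** The trace at [M%:R^-1 *: A] is a polynomial in [M%:R^-1] whose coefficients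
    are the traces of the homogeneous components. *)
Lemma homogeneous_trace_eq0 f : (0 < d)%N ->
  (forall A : 'I_n -> 'M[K]_d,
     (forall i, selfadjoint (A i) /\ contraction (A i)) ->
     \tr (evalmx A f) = 0) ->
  forall (m : nat) (A : 'I_n -> 'M[K]_d), (forall i, selfadjoint (A i)) ->
    \sum_(v <- msupp f | size v == m) f@_v * \tr (\prod_(i <- (v : seq _)) A i) = 0.
Proof.
move=> d_gt0 trf0 m A Asa.
pose p : {poly K} := \sum_(v <- msupp f)
  (f@_v * \tr (\prod_(i <- (v : seq _)) A i)) *: 'X^(size v).
have [N AN] : exists N : nat, forall M : nat, (N <= M)%N ->
    forall i, contraction (M%:R^-1 *: A i).
  have [N_ N_P] := choice (fun i => contraction_natV (A i) d_gt0).
  exists (\max_i N_ i) => M leM i; apply: N_P.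
  by apply: leq_trans leM; apply: leq_bigmax.
suff p_eq0 : p = 0.
  have /(congr1 (fun q : {poly K} => q`_m)) := p_eq0.
  rewrite coef0 coef_sum => sum0; rewrite -[RHS]sum0 big_mkcond.
  apply: eq_bigr => v _; rewrite coefZ coefXn eq_sym.
  by case: eqP => _; rewrite ?mulr1 ?mulr0.
apply: (@poly_natV_roots_eq0 _ _ N) => M leNM.
rewrite -[RHS](trf0 (fun i => M%:R^-1 *: A i)); last first.
  by move=> i; split; [apply: selfadjoint_natV | apply: AN].
rewrite /evalmx raddf_sum horner_sum; apply: eq_bigr => v _ /=.
rewrite hornerZ hornerXn mxtraceZ prod_scale_mx mxtraceZ -mulrA; congr (_ * _).
rewrite mulrC; congr (_ * _).
by rewrite big_const_seq count_predT iter_mulr mulr1.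
Qed.

End Homogeneity.

(** * Sums of coefficients over the rotations of a word *)

Section Words.
Context {R : realType} {k : base_field} {n : nat}.
Local Notation K := (scalars R k).
Implicit Types f g : freeAlg R k n.

Lemma mcoeff_star f (v : seq 'I_n) :
  (star f)@_(FMonom v) = conjK f@_(FMonom (rev v)).
Proof.
rewrite /star raddf_sum /=; pose u := FMonom (rev v).
have coeff_word (x : {fmonom 'I_n}) : FMonom (rev x) == FMonom v = (x == u).
  by rewrite -!val_eqE /= -(inj_eq (can_inj revK)) revK.
under eq_bigr => x _ do rewrite mcoeffU coeff_word mulrb.
rewrite -big_mkcond sum_msupp_pred1 // => us.
by rewrite mcoeff_outdom ?conjK0.
Qed.

Lemma map_codom_rotation (m : nat) (v : m.+1.-tuple 'I_n) (s : 'I_m.+1) :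
  map (tnth v) (codom (rotation s)) = rot s v.
Proof.
have sz_v := size_tuple v.
apply: (@eq_from_nth _ (tnth v ord0)) => [|l].
  by rewrite size_map size_codom card_ord size_rot sz_v.
rewrite size_map size_codom card_ord => lt_l.
rewrite codomE -map_comp (nth_map ord0) ?size_enum_ord //=.
rewrite (tnth_nth (tnth v ord0)) ffunE /= nth_enum_ord //.
rewrite /rot nth_cat size_drop nth_drop sz_v.
have lt_s := ltn_ord s; have [lt_sl|ge_sl] := ltnP.
  by rewrite modn_small // -ltn_subRL.
rewrite nth_take; last by rewrite ltn_subLR // subnK // ltnW.
congr nth; rewrite leq_subLR in ge_sl.
rewrite -{1}(subnK ge_sl) modnDr modn_small; first by rewrite subnBA 1?ltnW // addnC.
by rewrite ltn_subLR // -addnS leq_add // ltnW.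
Qed.

End Words.

Lemma polarization_edges_eq0 (R : realType) (k : base_field) (n : nat)
    (f : freeAlg R k n) (d m : nat) (le_md : (m.+1 <= d)%N)
    (w : 'I_m.+1 -> 'I_n) :
  (forall B : 'I_m.+1 -> 'M[scalars R k]_d, (forall j, selfadjoint (B j)) ->
    polarization f w B = 0) ->
  (k = RealField -> f = star f) ->
  polarization f w (edge_mx le_md) = 0.
Proof.
case: k f => f sa0 f_star.
  apply: polarization_edges_symmetric => [v|B Bsym].
    by rewrite [in LHS]f_star // mcoeff_star revK.
  by apply: sa0 => j; rewrite /selfadjoint -[RHS]Bsym; congr trmx; apply: map_mx_id.
pose i : scalars R ComplexField := 'i%C.
apply: (@polarization_edges_hermitian _ _ _ _ _ _ _ i).
  by rewrite -expr2; exact: sqr_i.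
pose E := edge_mx (K := scalars R ComplexField) le_md.
have adjE l : adjmx (E l) = (E l)^T.
  by rewrite /E /edge_mx adjmx_delta trmx_delta.
have adjET l : adjmx (E l)^T = E l by rewrite -adjE adjmxK.
move=> B B_eq; apply: sa0 => j; rewrite /selfadjoint.
case: (B_eq j) => -> {B_eq}; rewrite -/(E j).
  by rewrite adjmxD adjE adjET addrC.
have conj_i : conjK (- i) = i by rewrite /= /i; simpc.
by rewrite adjmxZ adjmxB adjE adjET conj_i -opprB scalerN scaleNr.
Qed.

Section CyclicEquivalence.
Context {R : realType} {k : base_field} {n : nat}.
Local Notation K := (scalars R k).
Implicit Types f g : freeAlg R k n.

(** Words longer than [d] are not in the support of [f]; for the others the
    cycle of length [size v] fits into matrices of size [d]. *)
Lemma sum_rotations_eq0 f (d : nat) : (0 < d)%N -> degree_at_most d f ->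
  (forall A : 'I_n -> 'M[K]_d,
     (forall i, selfadjoint (A i) /\ contraction (A i)) ->
     \tr (evalmx A f) = 0) ->
  (k = RealField -> f = star f) ->
  forall v : seq 'I_n, v != [::] ->
    \sum_(s < size v) f@_(FMonom (rot s v)) = 0.
Proof.
move=> d_gt0 deg_f trf0 f_star v; rewrite -size_eq0 -lt0n => v_gt0.
have [le_vd|lt_dv] := leqP (size v) d; last first.
  rewrite big1 // => s _; apply: mcoeff_outdom; apply: mmeasure_mnm_ge.
  apply: leq_trans deg_f _.
  by rewrite [X in (_ < X)%N](_ : _ = size v) //; exact: size_rot.
case def_m: (size v) v_gt0 le_vd => [//|m] _ le_md.
have sz_v : size v == m.+1 by rewrite def_m.
rewrite -[v]/(tval (Tuple sz_v)); move: (Tuple sz_v) => t.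
under eq_bigr => s _ do rewrite -map_codom_rotation.
rewrite -(polarization_edges le_md) polarization_edges_eq0 // => B Bsa.
apply: (@polarization_eq0 _ _ _ _ _ _ _ selfadjoint) => //.
- exact: adjmx0.
- by move=> X Y SX SY; rewrite /selfadjoint adjmxB SX SY.
by move=> A SA; apply: homogeneous_trace_eq0.
Qed.

(** The homogeneous component of degree 0 has trace [d] times the constant
    coefficient. *)
Lemma constant_coefficient_eq0 f (d : nat) : (0 < d)%N ->
  (forall A : 'I_n -> 'M[K]_d,
     (forall i, selfadjoint (A i) /\ contraction (A i)) ->
     \tr (evalmx A f) = 0) ->
  f@_(FMonom [::]) = 0.
Proof.
move=> d_gt0 trf0.
have := homogeneous_trace_eq0 d_gt0 trf0 0 (A := fun=> 0) (fun=> adjmx0).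
rewrite (eq_bigl (pred1 (FMonom [::]))) => [|v]; last first.
  by rewrite /= size_eq0 -val_eqE.
rewrite sum_msupp_pred1 => [|us]; last by rewrite mcoeff_outdom ?mul0r.
rewrite big_nil mxtrace1 => /eqP.
by rewrite mulf_eq0 pnatr_eq0 (gtn_eqF d_gt0) orbF => /eqP.
Qed.

(** * From sums over rotations to commutators *)

Lemma cyclically_equivalent0_sum (I : Type) (r : seq I) (F : I -> freeAlg R k n) :
  (forall i, cyclically_equivalent (F i) 0) ->
  cyclically_equivalent (\sum_(i <- r) F i) 0.
Proof.
move=> F0; elim: r => [|i r [s eq_s]].
  by exists [::]; rewrite !big_nil subrr.
have [s' eq_s'] := F0 i; exists (s' ++ s).
by rewrite big_cons big_cat /= -eq_s -eq_s' !subr0.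
Qed.

Lemma cyclically_equivalent_rotation (c : K) (v : seq 'I_n) (s : nat) :
  cyclically_equivalent
    (<< c *g FMonom v >> - << c *g FMonom (rotr s v) >> : freeAlg R k n) 0.
Proof.
pose p := take (size v - s) v; pose q := drop (size v - s) v.
exists [:: (<< c *g FMonom p >>, << FMonom q >>)].
have mulE (a b : K) (x y : seq 'I_n) : << a *g FMonom x >> * << b *g FMonom y >> =
    << a * b *g FMonom (x ++ y) >> :> freeAlg R k n.
  by rewrite malgM_def fgmulUU -[mmul _ _]fmK fmM.
by rewrite big_seq1 subr0 !mulE mulr1 mul1r cat_take_drop.
Qed.

(** Modulo commutators each word of length l may be replaced by the mean of its
    l rotations; the coefficient at u of the resulting element is the mean of
    the coefficients of [f] at the rotations of u. *)
Lemma cyclically_equivalent_of_rotation_sums f :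
  f@_(FMonom [::]) = 0 ->
  (forall v, v != [::] -> \sum_(s < size v) f@_(FMonom (rot s v)) = 0) ->
  cyclically_equivalent f 0.
Proof.
move=> f1 rot0.
pose c (v : {fmonom 'I_n}) : K := f@_v / (size v)%:R.
pose D (v : {fmonom 'I_n}) : freeAlg R k n := \sum_(s < size v)
  (<< c v *g v >> - << c v *g FMonom (rotr s v) >>).
suff -> : f = \sum_(v <- msupp f) D v.
  apply: cyclically_equivalent0_sum => v; apply: cyclically_equivalent0_sum => s.
  by rewrite -{1}[v]fmK; apply: cyclically_equivalent_rotation.
(* The hypothesis is about left rotations: a word u is the right rotation by s of
   exactly one word, the left rotation of u by s. *)
have avg0 : \sum_(v <- msupp f) \sum_(s < size v)
    << c v *g FMonom (rotr s v) >> = 0 :> freeAlg R k n.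
  apply/malgP => u; rewrite mcoeff0 raddf_sum /=.
  under eq_bigr => v _ do rewrite raddf_sum /=.
  have [u_nil|u_neq0] := eqVneq (u : seq 'I_n) [::].
    rewrite big1 // => v _; rewrite big1 // => s _; rewrite mcoeffU.
    case: eqP => // /(congr1 (size \o val)); rewrite /= u_nil size_rotr /= => sz_v.
    by case: s => s' /=; rewrite sz_v.
  transitivity ((\sum_(s < size u) f@_(FMonom (rot s u))) / (size u)%:R);
    last by rewrite rot0 ?mul0r.
  have coefE (v : {fmonom 'I_n}) :
      \sum_(s < size v) << c v *g FMonom (rotr s v) >>@_u =
      \sum_(s < size u) (if v == FMonom (rot s u) then c v else 0).
    have [sz_v|sz_v] := eqVneq (size v) (size u).
      rewrite sz_v; apply: eq_bigr => s _; rewrite mcoeffU mulrb.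
      by rewrite -!val_eqE /= -(inj_eq (@rot_inj s _)) rotrK.
    rewrite !big1 // => s _; rewrite ?mcoeffU; case: eqP => // eq_v.
      by rewrite eq_v /= size_rot eqxx in sz_v.
    by rewrite -eq_v /= size_rotr eqxx in sz_v.
  under eq_bigr => v _ do rewrite coefE.
  rewrite exchange_big /= mulr_suml; apply: eq_bigr => s _.
  rewrite -big_mkcond sum_msupp_pred1 /c => [|us]; first by rewrite /= size_rot.
  by rewrite mcoeff_outdom ?mul0r.
rewrite [LHS]monalgE -[LHS]subr0 -[X in _ - X = _]avg0 -sumrB !big_seq.
apply: eq_bigr => v vs.
rewrite /D sumrB sumr_const card_ord; congr (_ - _).
rewrite -monalgUMn (_ : c v *+ size v = f@_v) // /c -[LHS]mulr_natr divfK //.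
rewrite pnatr_eq0 size_eq0.
apply: contraTneq vs => v_nil.
by rewrite -mcoeff_eq0 -[v]fmK v_nil f1.
Qed.

End CyclicEquivalence.

Theorem theorem2p1 (R : realType) (k : base_field) (n d : nat)
    (f : freeAlg R k n) :
  (0 < n)%N -> (0 < d)%N ->
  degree_at_most d f ->
  (forall A : 'I_n -> 'M[scalars R k]_d,
     (forall i, selfadjoint (A i) /\ contraction (A i)) ->
     \tr (evalmx A f) = 0) ->
  (k = RealField -> f = star f) ->
  cyclically_equivalent f 0.

Proof.
move=> _ d_gt0 deg_f trf0 f_star.
apply: cyclically_equivalent_of_rotation_sums.
  exact: constant_coefficient_eq0 d_gt0 trf0.
exact: sum_rotations_eq0 d_gt0 deg_f trf0 f_star.
Qed.
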